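(* Let $\Theta\subset\mathbb{R}^p$ and $\Lambda\subset\mathbb{R}^q$ be open. Let $\{p_\theta\}_{\theta\in\Theta}$ be a parametric family defined by a graphical model on a graph $G=(V,E)$, let $g_0,\ldots,g_K$ be sufficient statistics or interaction functions, let $\{\varphi_\lambda\}_{\lambda\in\Lambda}$ be a family of kernels, and set $$\Phi_\lambda(\theta)=\bigl(\mathrm{E}_\theta[g_j(X)\varphi_\lambda(X)]\bigr)_{j=0}^{K}\in\mathbb{R}^{K+1},\qquad F(\theta,\lambda)=\Phi_\lambda(\theta).$$ Suppose that: (a) the $(K+1)\times p$ matrix with entries $\mathrm{E}_\theta\bigl[g_j\,\varphi_\lambda\,\partial_{\theta_a}\log p_\theta\bigr]$, $j=0,\ldots,K$, $a=1,\ldots,p$, has full column rank $p$ at every $\theta\in\Theta$ (and every $\lambda\in\Lambda$); and (b) at every $(\theta,\lambda)$, the kernel derivatives $\partial_{\lambda_b}\varphi_\lambda$ generate at least $K+1-p$ directions outside $\operatorname{Im}(D_\theta\Phi_\lambda(\theta))$, i.e. among the vectors $\bigl(\mathrm{E}_\theta[g_j(X)\,\partial_{\lambda_b}\varphi_\lambda(X)]\bigr)_{j=0}^{K}$, $b=1,\ldots,q$, there are at least $K+1-p$ that are linearly independent modulo $\operatorname{Im}(D_\theta\Phi_\lambda(\theta))$. Then $F$ is transversal to $D$ for every smooth submanifold $D\subset\mathbb{R}^{K+1}$.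
   Context: A kernel is a positive function in the Schwartz space. $p_\theta$ denotes the density of the model, $\mathrm{E}_\theta$ expectation for $X\sim p_\theta$. The model and kernel family are regular enough that $F$ is continuously differentiable with derivatives computed under the expectation: $$\frac{\partial}{\partial\theta_a}\mathrm{E}_\theta[g_j\varphi_\lambda]=\mathrm{E}_\theta[g_j\varphi_\lambda\,\partial_{\theta_a}\log p_\theta],\qquad \frac{\partial}{\partial\lambda_b}\mathrm{E}_\theta[g_j\varphi_\lambda]=\mathrm{E}_\theta[g_j\,\partial_{\lambda_b}\varphi_\lambda].$$ $F$ is transversal to $D$ if for every $(\theta,\lambda)\in F^{-1}(D)$ one has $\operatorname{Im}DF(\theta,\lambda)+T_{F(\theta,\lambda)}D=\mathbb{R}^{K+1}$. *)

(* Defs.v *)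
From HB Require Import structures.
From mathcomp Require Export all_boot all_order all_algebra.
From mathcomp Require Export all_classical all_reals all_analysis.
Export Order.TTheory GRing.Theory Num.Theory numFieldNormedType.Exports.

Set Implicit Arguments.
Unset Strict Implicit.
Unset Printing Implicit Defensive.

Open Scope classical_set_scope.
Open Scope ring_scope.

(** * Differential calculus *)

Definition iter_derive {R : realType} {U W : normedModType R}
    (f : U -> W) (s : seq U) : U -> W :=
  foldr (fun v h => fun x => 'D_v h x) f s.

(* C^oo on A; A is meant to be open. *)
Definition smooth_on {R : realType} {U W : normedModType R}
    (A : set U) (f : U -> W) : Prop :=
  forall (s : seq U) (x : U), A x -> differentiable (iter_derive f s) x.

(* In finite dimension, continuity of y |-> 'D_v f y for each v is continuity
   of y |-> 'd f y in operator norm. *)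
Definition C1_on {R : realType} {U W : normedModType R}
    (A : set U) (f : U -> W) : Prop :=
  forall x : U, A x ->
    differentiable f x /\ forall v : U, {for x, continuous (fun y => 'D_v f y)}.

Definition basis_vec {R : realType} {n : nat} (i : 'I_n) : 'rV[R]_n :=
  delta_mx 0 i.

Definition schwartz {R : realType} {n : nat} (f : 'rV[R]_n -> R) : Prop :=
  smooth_on setT f /\
  forall (a : 'I_n -> nat) (s : seq 'I_n), exists C : R, forall x : 'rV[R]_n,
    `|(\prod_i x 0 i ^+ a i) * iter_derive f (map basis_vec s) x| <= C.

Definition kernel_function {R : realType} {n : nat} (f : 'rV[R]_n -> R) : Prop :=
  schwartz f /\ forall x : 'rV[R]_n, 0 < f x.

(** * Submanifolds of R^n and transversality *)

(* Embedded submanifold without boundary, given by slice charts psi : U -> psi(U)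
   with smooth inverse psi'. *)
Definition smooth_submanifold {R : realType} {n : nat} (D : set 'rV[R]_n) : Prop :=
  exists2 d : nat, (d <= n)%N & forall y : 'rV[R]_n, D y ->
    exists (U : set 'rV[R]_n) (psi psi' : 'rV[R]_n -> 'rV[R]_n),
      [/\ open U /\ U y,
          open (psi @` U),
          smooth_on U psi /\ smooth_on (psi @` U) psi',
          (forall x, U x -> psi' (psi x) = x) &
          forall x, U x -> (D x <-> forall i : 'I_n, (d <= i)%N -> psi x 0 i = 0)].

(* Velocities at y of smooth curves in D through y. *)
Definition tangent_space {R : realType} {n : nat} (D : set 'rV[R]_n)
    (y : 'rV[R]_n) : set 'rV[R]_n :=
  [set w | exists (c : R -> 'rV[R]_n) (e : R),
    [/\ 0 < e, smooth_on (ball (0 : R) e) c,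
        (forall t : R, ball (0 : R) e t -> D (c t)),
        c 0 = y & 'D_1 c 0 = w]].

(* F is regarded as a map on A only. *)
Definition transversal_on {R : realType} {U : normedModType R} {n : nat}
    (A : set U) (F : U -> 'rV[R]_n) (D : set 'rV[R]_n) : Prop :=
  forall z : U, A z -> D (F z) ->
    [set u + w | u in range ('d F z) & w in tangent_space D (F z)] = setT.

Definition independent_modulo {R : realType} {I : finType} {n : nat}
    (v : I -> 'rV[R]_n) (B : {set I}) (M : set 'rV[R]_n) : Prop :=
  forall c : I -> R, M (\sum_(b in B) c b *: v b) ->
    forall b, b \in B -> c b = 0.

(** * Graphical models *)

(* R^n with its Borel sigma-algebra. *)
Definition borel_rV (R : realType) (n : nat) :=
  g_sigma_algebraType (@open 'rV[R]_n).

(* The state x_v of the vertex v in the configuration x in R^V. *)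
Definition state {R : realType} {V : finType} (x : 'rV[R]_#|V|) (v : V) : R :=
  x 0 (enum_rank v).

Definition depends_on {R : realType} {V : finType} (C : {set V})
    (h : 'rV[R]_#|V| -> R) : Prop :=
  forall x y : 'rV[R]_#|V|,
    (forall v, v \in C -> state x v = state y v) -> h x = h y.

(* The empty set and singletons are cliques. *)
Definition clique {V : finType} (E : rel V) (C : {set V}) : bool :=
  [forall u in C, forall v in C, (u != v) ==> E u v].

Definition borel_fun {R : realType} {n : nat} (h : 'rV[R]_n -> R) : Prop :=
  measurable_fun setT (h : borel_rV R n -> R).

Definition factorizes {R : realType} {V : finType} (E : rel V)
    (f : 'rV[R]_#|V| -> R) : Prop :=
  exists psi : {set V} -> 'rV[R]_#|V| -> R,
    (forall C, clique E C ->
       [/\ borel_fun (psi C), (forall x, 0 <= psi C x) & depends_on C (psi C)]) /\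
    (forall x, f x = \prod_(C : {set V} | clique E C) psi C x).

(* mu is the product of the sigma-finite measures nu v: Lebesgue measure on R^V
   when every nu v is Lebesgue measure, a counting measure for discrete models. *)
Definition product_reference {R : realType} {V : finType}
    (nu : V -> {sigma_finite_measure set (measurableTypeR R) -> \bar R})
    (mu : {measure set (borel_rV R #|V|) -> \bar R}) : Prop :=
  forall A : V -> set (measurableTypeR R), (forall v, measurable (A v)) ->
    mu [set x | forall v, A v (state (x : 'rV[R]_#|V|) v)]
    = (\prod_(v : V) nu v (A v))%E.

Definition has_density {R : realType} {n : nat}
    (mu : {measure set (borel_rV R n) -> \bar R})
    (P : probability (borel_rV R n) R) (f : 'rV[R]_n -> R) : Prop :=
  [/\ borel_fun f, (forall x, 0 <= f x) &
      forall A : set (borel_rV R n), measurable A ->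
        P A = (\int[mu]_(x in A) (f x)%:E)%E].

Definition graphical_model {R : realType} {V : finType} (E : rel V) {p : nat}
    (mu : {measure set (borel_rV R #|V|) -> \bar R}) (Theta : set 'rV[R]_p)
    (P : 'rV[R]_p -> probability (borel_rV R #|V|) R)
    (dens : 'rV[R]_p -> 'rV[R]_#|V| -> R) : Prop :=
  forall theta, Theta theta ->
    has_density mu (P theta) (dens theta) /\ factorizes E (dens theta).

(* S is sufficient: every event has a version of its conditional probability
   given S that is common to all theta in Theta. *)
Definition sufficient {R : realType} {n m p : nat} (Theta : set 'rV[R]_p)
    (P : 'rV[R]_p -> probability (borel_rV R n) R)
    (S : borel_rV R n -> borel_rV R m) : Prop :=
  forall A : set (borel_rV R n), measurable A ->
    exists h : borel_rV R m -> R, measurable_fun setT h /\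
      forall theta, Theta theta -> forall B : set (borel_rV R m), measurable B ->
        P theta (A `&` S @^-1` B)
        = (\int[P theta]_(x in S @^-1` B) (h (S x))%:E)%E.

Definition interaction_function {R : realType} {V : finType} (E : rel V)
    (h : 'rV[R]_#|V| -> R) : Prop :=
  exists2 C : {set V}, clique E C & depends_on C h.

(* The g j with j in J form a sufficient statistic, the others are interaction
   functions; J may be everything or empty. The coordinates outside J are
   replaced by the constant 0, which does not change the generated sigma-algebra. *)
Definition statistics_or_interactions {R : realType} {V : finType} (E : rel V)
    {p K : nat} (Theta : set 'rV[R]_p)
    (P : 'rV[R]_p -> probability (borel_rV R #|V|) R)
    (g : 'I_K.+1 -> 'rV[R]_#|V| -> R) : Prop :=
  (forall j, borel_fun (g j)) /\
  exists J : {set 'I_K.+1},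
    (J != finset.set0 ->
       sufficient Theta P
         (fun x => \row_j (if j \in J then g j x else 0) : borel_rV R K.+1)) /\
    (forall j, j \notin J -> interaction_function E (g j)).

(** * The feature map *)

Section FeatureMap.
Context {R : realType} {n p q K : nat}.
Variables (P : 'rV[R]_p -> probability (borel_rV R n) R).
Variables (dens : 'rV[R]_p -> 'rV[R]_n -> R).
Variables (g : 'I_K.+1 -> 'rV[R]_n -> R).
Variables (phi : 'rV[R]_q -> 'rV[R]_n -> R).

Definition Esp (theta : 'rV[R]_p) (h : 'rV[R]_n -> R) : R :=
  fine ('E_(P theta)[(h : borel_rV R n -> R)])%E.

Definition has_mean (theta : 'rV[R]_p) (h : 'rV[R]_n -> R) : Prop :=
  (P theta).-integrable setT (EFin \o (h : borel_rV R n -> R)).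

Definition score (theta : 'rV[R]_p) (a : 'I_p) (x : 'rV[R]_n) : R :=
  'D_(basis_vec a) (fun t => ln (dens t x)) theta.

Definition dkernel (lambda : 'rV[R]_q) (b : 'I_q) (x : 'rV[R]_n) : R :=
  'D_(basis_vec b) (fun l => phi l x) lambda.

Definition Phi (lambda : 'rV[R]_q) (theta : 'rV[R]_p) : 'rV[R]_K.+1 :=
  \row_j Esp theta (fun x => g j x * phi lambda x).

Definition feature_map (z : 'rV[R]_p * 'rV[R]_q) : 'rV[R]_K.+1 := Phi z.2 z.1.

Definition score_mx (theta : 'rV[R]_p) (lambda : 'rV[R]_q) : 'M[R]_(K.+1, p) :=
  \matrix_(j, a) Esp theta (fun x => g j x * phi lambda x * score theta a x).

Definition kernel_direction (theta : 'rV[R]_p) (lambda : 'rV[R]_q) (b : 'I_q) :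
    'rV[R]_K.+1 :=
  \row_j Esp theta (fun x => g j x * dkernel lambda b x).

(* The log-density may fail to be differentiable where p_theta vanishes, hence
   the almost-everywhere clauses. *)
Definition regular_family (Theta : set 'rV[R]_p) (Lambda : set 'rV[R]_q) : Prop :=
  C1_on (Theta `*` Lambda) feature_map /\
  forall theta lambda, Theta theta -> Lambda lambda ->
    [/\ forall j, has_mean theta (fun x => g j x * phi lambda x),
        forall a,
          {ae P theta, forall x : borel_rV R n,
             derivable (fun t => ln (dens t x)) theta (basis_vec a)} /\
          forall j,
            has_mean theta (fun x => g j x * phi lambda x * score theta a x) /\
            'D_(basis_vec a) (fun t => Esp t (fun x => g j x * phi lambda x)) theta
            = Esp theta (fun x => g j x * phi lambda x * score theta a x) &
        forall b,
          {ae P theta, forall x : borel_rV R n,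
             derivable (fun l => phi l x) lambda (basis_vec b)} /\
          forall j,
            has_mean theta (fun x => g j x * dkernel lambda b x) /\
            'D_(basis_vec b) (fun l => Esp theta (fun x => g j x * phi l x)) lambda
            = Esp theta (fun x => g j x * dkernel lambda b x)].

End FeatureMap.

(* Main.v *)
Require Import Defs.

Set Implicit Arguments.
Unset Strict Implicit.
Unset Printing Implicit Defensive.

(** Condition (a) makes the p partial derivatives of F in theta independent, so
    they span a p-dimensional space, the image of D_theta Phi.  Condition (b)
    adds at least K+1-p partial derivatives in lambda that are independent modulo
    this image.  Counting dimensions, the image of DF is all of R^(K+1): F is a
    submersion on Theta x Lambda.  A submersion is transversal to any set,
    since a tangent space always contains the zero vector.

    The analytic content is the identification of the two families of vectors
    with values of DF at (u, 0) and (0, v).  It combines the chain rule along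
    the slices of the product ([is_diff_slicel], [is_diff_slicer]) with the
    differentiation under the expectation provided by [regular_family].  The
    dimension count is [independent_modulo_span]. *)

Lemma iter_derive_cst (R : realType) (U W : normedModType R) (w : W)
    (s : seq U) :
  exists w', iter_derive (fun _ : U => w) s = (fun=> w').
Proof.
elim: s => [|v s [w' /= ->]]; first by exists w.
by exists 0; apply/funext => x; rewrite derive_cst.
Qed.

Lemma smooth_on_cst (R : realType) (U W : normedModType R) (A : set U) (w : W) :
  smooth_on A (fun=> w).
Proof. by move=> s x _; have [w' ->] := iter_derive_cst w s. Qed.

(** The constant curve has velocity zero. *)
Lemma tangent_space0 (R : realType) (n : nat) (D : set 'rV[R]_n) (y : 'rV[R]_n) :
  D y -> tangent_space D y 0.
Proof.
move=> Dy; exists (fun=> y), 1; split => //; first exact: smooth_on_cst.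
by rewrite derive_cst.
Qed.

Lemma submersion_transversal (R : realType) (U : normedModType R) (n : nat)
    (A : set U) (F : U -> 'rV[R]_n) (D : set 'rV[R]_n) :
  (forall z, A z -> range ('d F z) = setT) -> transversal_on A F D.
Proof.
move=> subF z Az DFz; apply/seteqP; split => // y _.
have : range ('d F z) y by rewrite subF.
by exists y => //; exists 0; [exact: tangent_space0|rewrite addr0].
Qed.

Section Slices.
Context {R : realType} {U1 U2 W : normedModType R}.
Variables (F : U1 * U2 -> W) (x1 : U1) (x2 : U2).
Hypothesis dF : differentiable F (x1, x2).

Lemma is_diff_slicel :
  is_diff x1 (fun t => F (t, x2)) (fun u => 'd F (x1, x2) (u, 0)).
Proof.
have dp : is_diff x1 (fun t : U1 => (t, x2)) (fun u : U1 => (u, 0 : U2)).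
  exact: is_diff_pair.
have dF' : is_diff (x1, x2) F ('d F (x1, x2)) by exact: DiffDef.
exact: (is_diff_comp dp dF').
Qed.

Lemma is_diff_slicer :
  is_diff x2 (fun t => F (x1, t)) (fun u => 'd F (x1, x2) (0, u)).
Proof.
have dp : is_diff x2 (fun t : U2 => (x1, t)) (fun u : U2 => (0 : U1, u)).
  exact: is_diff_pair.
have dF' : is_diff (x1, x2) F ('d F (x1, x2)) by exact: DiffDef.
exact: (is_diff_comp dp dF').
Qed.

End Slices.

Lemma diff_row (R : realType) (U : normedModType R) (n : nat)
    (f : 'I_n -> U -> R) (x v : U) :
  differentiable (fun t => \row_j f j t) x ->
  'd (fun t => \row_j f j t) x v = \row_j 'D_v (f j) x.
Proof.
move=> df; rewrite -deriveE// derive_mx; last exact: diff_derivable.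
apply/rowP => j; rewrite !mxE; congr ('D_v _ x).
by apply/funext => t; rewrite mxE.
Qed.

(** Since M contains the row space of T, the v b with b in B are independent and
    their span meets this row space only in 0: the dimensions add up to at
    least n. *)
Lemma independent_modulo_span (R : realType) (I : finType) (p n : nat)
    (T : 'M[R]_(p, n)) (v : I -> 'rV[R]_n) (B : {set I}) (M : set 'rV[R]_n) :
  (forall u, M (u *m T)) -> independent_modulo v B M ->
  (n <= \rank T + #|B|)%N ->
  forall y, exists (u : 'rV_p) (c : I -> R),
    y = u *m T + \sum_(b in B) c b *: v b.
Proof.
move=> MT indB leqn.
pose S := \matrix_(k < #|B|) v (enum_val k).
(* Independence modulo M quantifies over coefficients indexed by I: a row of
   coefficients on B is extended by zero. *)
pose coef (w : 'rV[R]_#|B|) (b : I) : R :=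
  if [pick k | enum_val k == b] is Some k then w 0 k else 0.
have coefE w k : coef w (enum_val k) = w 0 k.
  rewrite /coef; case: pickP => [k' /eqP/enum_val_inj -> //|/(_ k)].
  by rewrite eqxx.
have mulS w : w *m S = \sum_(b in B) coef w b *: v b.
  rewrite mulmx_sum_row [RHS]big_enum_val; apply: eq_bigr => k _.
  by rewrite coefE rowK.
have S_mod (w : 'rV_#|B|) : (w *m S <= T)%MS -> w = 0.
  move=> /submxP[u wSuT]; apply/rowP => k; rewrite mxE -coefE.
  apply: indB; last exact: enum_valP.
  by rewrite -mulS wSuT.
have rkS : \rank S = #|B|.
  by apply/eqP/inj_row_free => w wS0; apply: S_mod; rewrite wS0 sub0mx.
have capTS : (T :&: S)%MS = 0.
  apply/eqP; rewrite -submx0; apply/rV_subP => u.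
  rewrite sub_capmx => /andP[uT /submxP[w uE]].
  by rewrite uE (S_mod w) ?mul0mx ?sub0mx// -uE.
have fullTS : row_full (T + S)%MS.
  by rewrite -col_leq_rank (mxrank_disjoint_sum capTS) rkS.
move=> y; have /sub_addsmxP[[u w] /= ->] := submx_full y fullTS.
by exists u, (coef w); rewrite mulS.
Qed.

Section FeatureMapSubmersion.
Context {R : realType} {n p q K : nat}.
Variables (P : 'rV[R]_p -> probability (borel_rV R n) R).
Variables (dens : 'rV[R]_p -> 'rV[R]_n -> R).
Variables (g : 'I_K.+1 -> 'rV[R]_n -> R).
Variables (phi : 'rV[R]_q -> 'rV[R]_n -> R).
Variables (Theta : set 'rV[R]_p) (Lambda : set 'rV[R]_q).
Hypothesis hreg : regular_family P dens g phi Theta Lambda.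
Variables (theta : 'rV[R]_p) (lambda : 'rV[R]_q).
Hypotheses (thetaP : Theta theta) (lambdaP : Lambda lambda).

Let F := feature_map P g phi.

Lemma differentiable_feature_map : differentiable F (theta, lambda).
Proof. by case: hreg => /(_ (theta, lambda) (conj thetaP lambdaP))[]. Qed.

Let is_diff_theta :
  is_diff theta (Phi P g phi lambda) (fun u => 'd F (theta, lambda) (u, 0)).
Proof. exact: (is_diff_slicel differentiable_feature_map). Qed.

Let is_diff_lambda :
  is_diff lambda (fun l => Phi P g phi l theta)
    (fun v => 'd F (theta, lambda) (0, v)).
Proof. exact: (is_diff_slicer differentiable_feature_map). Qed.

Lemma diff_Phi u : 'd (Phi P g phi lambda) theta u = 'd F (theta, lambda) (u, 0).
Proof. by rewrite (diff_val (is_diff_def := is_diff_theta)). Qed.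

(** Differentiation under the expectation turns the partial derivatives of F in
    theta into the columns of the score matrix; the transpose appears because
    vectors are rows. *)
Lemma diff_feature_map_theta u :
  'd F (theta, lambda) (u, 0) = u *m (score_mx P dens g phi theta lambda)^T.
Proof.
rewrite -diff_Phi [in LHS](row_sum_delta u) linear_sum mulmx_sum_row.
apply: eq_bigr => a _; rewrite linearZ; congr (_ *: _).
rewrite [LHS](diff_row _ (ex_diff (is_diff_def := is_diff_theta))).
apply/rowP => j; rewrite !mxE.
by case: hreg => _ /(_ _ _ thetaP lambdaP)[_ /(_ a)[_ /(_ j)[_ ->]] _].
Qed.

Lemma diff_feature_map_lambda b :
  'd F (theta, lambda) (0, basis_vec b) = kernel_direction P g phi theta lambda b.
Proof.
transitivity ('d (fun l => Phi P g phi l theta) lambda (basis_vec b)).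
  by rewrite (diff_val (is_diff_def := is_diff_lambda)).
rewrite [LHS](diff_row _ (ex_diff (is_diff_def := is_diff_lambda))).
apply/rowP => j; rewrite !mxE.
by case: hreg => _ /(_ _ _ thetaP lambdaP)[_ _ /(_ b)[_ /(_ j)[_ ->]]].
Qed.

Lemma feature_map_submersion (B : {set 'I_q}) :
  \rank (score_mx P dens g phi theta lambda) = p -> (K.+1 - p <= #|B|)%N ->
  independent_modulo (kernel_direction P g phi theta lambda) B
    (range ('d (Phi P g phi lambda) theta)) ->
  range ('d F (theta, lambda)) = setT.
Proof.
move=> rk leB indB; apply/seteqP; split => // y _.
have MT u : range ('d (Phi P g phi lambda) theta)
    (u *m (score_mx P dens g phi theta lambda)^T).
  by exists u => //; rewrite diff_Phi diff_feature_map_theta.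
have leK : (K.+1 <= \rank (score_mx P dens g phi theta lambda)^T + #|B|)%N.
  by rewrite mxrank_tr rk -leq_subLR.
have [u [c ->]] := independent_modulo_span MT indB leK y.
exists ((u, 0) + \sum_(b in B) c b *: (0, basis_vec b)) => //.
rewrite linearD linear_sum diff_feature_map_theta; congr (_ + _).
by apply: eq_bigr => b _; rewrite linearZ diff_feature_map_lambda.
Qed.

End FeatureMapSubmersion.

Theorem proposition5p10
  (R : realType) (V : finType) (E : rel V)
  (symE : symmetric E) (irrE : irreflexive E)
  (nu : V -> {sigma_finite_measure set (measurableTypeR R) -> \bar R})
  (mu : {measure set (borel_rV R #|V|) -> \bar R})
  (hmu : product_reference nu mu)
  (p q K : nat) (Theta : set 'rV[R]_p) (Lambda : set 'rV[R]_q)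
  (oTheta : open Theta) (oLambda : open Lambda)
  (P : 'rV[R]_p -> probability (borel_rV R #|V|) R)
  (dens : 'rV[R]_p -> 'rV[R]_#|V| -> R)
  (hmodel : graphical_model E mu Theta P dens)
  (g : 'I_K.+1 -> 'rV[R]_#|V| -> R)
  (hg : statistics_or_interactions E Theta P g)
  (phi : 'rV[R]_q -> 'rV[R]_#|V| -> R)
  (hphi : forall lambda, Lambda lambda -> kernel_function (phi lambda))
  (hreg : regular_family P dens g phi Theta Lambda)
  (ha : forall theta lambda, Theta theta -> Lambda lambda ->
     \rank (score_mx P dens g phi theta lambda) = p)
  (hb : forall theta lambda, Theta theta -> Lambda lambda ->
     exists2 B : {set 'I_q}, (K.+1 - p <= #|B|)%N &
       independent_modulo (kernel_direction P g phi theta lambda) B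
         (range ('d (Phi P g phi lambda) theta))) :
  forall D : set 'rV[R]_K.+1, smooth_submanifold D ->
    transversal_on (Theta `*` Lambda) (feature_map P g phi) D.
Proof.
move=> D _; apply: submersion_transversal => -[theta lambda] [/= Ht Hl].
have [B leB indB] := hb _ _ Ht Hl.
exact: (feature_map_submersion hreg Ht Hl (ha _ _ Ht Hl) leB indB).
Qed.
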